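(* The minimum cardinality of a subset of $\mathbb{F}_{13}^{2}$ having exactly four special directions is $65$.
   Context: $\mathbb{F}_{13}$ is the field with $13$ elements, and $\mathbb{F}_{13}^2$ is the affine plane over it. An affine direction is a parallel class of affine lines of $\mathbb{F}_{13}^2$; there are fourteen directions (the slopes $m\in\mathbb{F}_{13}$, with lines $y-mx=\text{const}$, and the vertical direction $\infty$, with lines $x=\text{const}$), and each direction partitions the plane into thirteen parallel lines. For a subset $S\subseteq\mathbb{F}_{13}^2$, a direction is called special for $S$ if the thirteen numbers $|S\cap\ell|$, with $\ell$ running over the thirteen lines of that direction, are not all equal. *)

(* Defs.v *)
From mathcomp Require Import all_boot all_order all_algebra.

Set Implicit Arguments.
Unset Strict Implicit.
Unset Printing Implicit Defensive.

Import GRing.Theory.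
Local Open Scope ring_scope.

Definition plane : finType := ('F_13 * 'F_13)%type.

(* A parallel class of lines is encoded by its slope, with [None] standing
   for the vertical direction. *)
Definition direction : finType := option 'F_13.

Definition line (d : direction) (c : 'F_13) : {set plane} :=
  match d with
  | Some m => [set p : plane | p.2 - m * p.1 == c]
  | None => [set p : plane | p.1 == c]
  end.

Definition special (S : {set plane}) (d : direction) : bool :=
  ~~ [forall c, forall c', #|S :&: line d c| == #|S :&: line d c'|].

Definition special_directions (S : {set plane}) : {set direction} :=
  [set d | special S d].

(* Main.v *)
Require Import Defs.
From mathcomp Require Import all_boot all_order all_algebra.
From mathcomp Require Import ring zify.

(** Write n_d(c) for the number of points of S on the line of direction d and
level c. Counting the points of S on the fourteen lines through a point P
gives |S| + 13 [P in S]. When some direction is not special, |S| = 13 k and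
the non-special directions contribute k each, so four special directions give
the identity (with l_d the linear form whose level lines have direction d)

    sum_(d special) n_d (l_d P) = 3 k + 13 [P in S]     for all points P.   (1)

_Lower bound._ Suppose k <= 4, and read (1) modulo 13: four functions of four
pairwise independent linear forms add up to a constant. Differencing along the
kernels of three of the forms kills the corresponding terms, so the third
difference of each n_d vanishes in F_13 and n_d is congruent to a polynomial
of degree at most two ([iter_diff_slice], [diff3_quadratic]). Its least
nonnegative residues sum to at most 13 k <= 52, which is very restrictive
([small_profile]):
 - degree 1 is impossible, since the residues would sum to 0 + ... + 12 = 78;
 - degree 0, for a nonconstant n_d, makes each n_d(c) either 0 or 13, hence S
   a union of parallel lines, which has a single special direction ([parallel_special]);
 - a (t - s)^2 + c with a nonzero has residue sum at least 52, with equality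
   only for c = 4 or c = 8 ([sum_quadratic_residues]).
So k = 4 and every special profile is of the last kind. The four vertices s_d
are the levels of one common point P ([common_centre]). At P, (1) reads:
four numbers, each equal to 4 or 8, have sum 12 or 12 + 13. This is absurd,
because the sum is a multiple of 4 and at least 16.

_Example._ Conversely, suppose that profiles n_d on a set of directions satisfy
an identity of the shape (1), for some set S, and have total 13 k. Then they
are the line counts of S, and the other directions are not special
([line_count_of_profile]). The relation
(x + y)^2 + (y - x)^2 - 2 x^2 - 2 y^2 = 0 makes the residues of 5 + (x + y)^2,
5 + (y - x)^2, 9 - 2 x^2 and 9 - 2 y^2 add up to 15 modulo 13; the sum takes
only the values 15 and 28, and the points where it is 28 form a set of 65
points whose special directions are the four directions used. *)

Set Implicit Arguments.
Unset Strict Implicit.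
Unset Printing Implicit Defensive.

Import GRing.Theory.
Local Open Scope ring_scope.

Local Notation F := 'F_13.

(** * Directions as linear forms *)

Definition form (d : direction) (p : plane) : F :=
  if d is Some m then p.2 - m * p.1 else p.1.

Lemma in_line d c p : (p \in line d c) = (form d p == c).
Proof. by case: d => [m|]; rewrite inE. Qed.

Lemma formD d (p v : F * F) : form d (p + v) = form d p + form d v.
Proof. by case: d => [m|] //=; ring. Qed.

Lemma formB d (p v : F * F) : form d (p - v) = form d p - form d v.
Proof. by case: d => [m|] //=; ring. Qed.

Lemma form_dual d d' (t t' : F) :
  d != d' -> exists p, form d p = t /\ form d' p = t'.
Proof.
case: d d' => [m|] [m'|] // neq.
- have nz : m - m' != 0 by rewrite subr_eq0; apply: contraNneq neq => ->.
  exists ((t' - t) / (m - m'), t + m * ((t' - t) / (m - m'))) => /=.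
  by split; field.
- by exists (t', t + m * t') => /=; split; ring.
- by exists (t, t' + m' * t) => /=; split; ring.
Qed.

(** Two distinct directions give coordinates on the plane: by [form_dual] the
pair of forms is onto, and the plane is finite. *)
Lemma form_inj d d' (p q : plane) :
  d != d' -> form d p = form d q -> form d' p = form d' q -> p = q.
Proof.
pose f (r : plane) : plane := (form d r, form d' r).
move=> neq eq1 eq2.
have /fin_all_exists [g fgK] (u : plane) : exists r, f r = u.
  by have [r [r1 r2]] := form_dual u.1 u.2 neq; exists r; rewrite /f r1 r2 -surjective_pairing.
by apply: (can_inj (canF_sym fgK)); rewrite /f eq1 eq2.
Qed.

Lemma form_neq_dir d : exists d' : direction, d' != d.
Proof. by case: d => [m|]; [exists None | exists (Some 0)]. Qed.

Lemma form_surj d (t : F) : exists p, form d p = t.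
Proof.
have [d' neq] := form_neq_dir d.
by have [p [_ <-]] := form_dual 0 t neq; exists p.
Qed.

(** A form of another direction takes each value exactly once on a line. *)
Lemma sum_line d d' (g : F -> nat) c :
  d != d' -> (\sum_(p in line d c) g (form d' p) = \sum_t g t)%N.
Proof.
move=> neq; rewrite (partition_big (form d') xpredT) //=; apply: eq_bigr => t _.
have [p [p1 p2]] := form_dual c t neq.
rewrite (big_pred1 p) ?p2 // => q; rewrite in_line.
apply/andP/eqP => [[/eqP q1 /eqP q2]|->]; last by rewrite p1 p2 !eqxx.
by apply: (form_inj neq); rewrite ?q1 ?q2.
Qed.

Lemma card_line d c : #|line d c| = 13%N.
Proof.
have [d' neq] := form_neq_dir d.
rewrite -sum1_card (sum_line (d' := d') (fun=> 1%N)) 1?eq_sym //.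
by rewrite sum_nat_const card_Fp ?muln1.
Qed.

Lemma form_sep (p q : plane) : p != q -> #|[set d | form d p == form d q]| = 1%N.
Proof.
move=> neq; have [d eqd] : exists d, form d p = form d q.
  have [eq1|neq1] := eqVneq p.1 q.1; first by exists None.
  exists (Some ((p.2 - q.2) / (p.1 - q.1))) => /=.
  have nz : p.1 - q.1 != 0 by rewrite subr_eq0.
  by field.
apply/eqP/cards1P; exists d; apply/setP=> d'; rewrite !inE.
apply/eqP/eqP => [eqd'|-> //]; apply: contraNeq neq => neq.
by apply/eqP; apply: (form_inj neq).
Qed.

Lemma card_direction : #|{: direction}| = 14%N.
Proof. by rewrite card_option card_Fp. Qed.

(** * Line counts of a set of points *)

Section LineCounts.

Variable S : {set plane}.

Definition line_count d c := #|S :&: line d c|.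

Lemma line_countE d c : line_count d c = (\sum_(p in S) (form d p == c))%N.
Proof.
rewrite /line_count -sum1_card [RHS](bigID (mem (line d c))) /= [X in (_ + X)%N]big1.
  rewrite addn0; apply: eq_big => p; first by rewrite inE.
  by rewrite inE in_line => /andP[_ ->].
by move=> p /andP[_]; rewrite in_line => /negbTE ->.
Qed.

Lemma line_count_mem d c : line_count d c = (\sum_(p in line d c) (p \in S))%N.
Proof.
rewrite /line_count -sum1_card big_mkcond [RHS]big_mkcond; apply: eq_bigr => p _.
by rewrite inE; case: (p \in S) (p \in line d c) => [] [].
Qed.

Lemma line_count_le d c : (line_count d c <= 13)%N.
Proof. by rewrite -(card_line d c) subset_leq_card ?subsetIr. Qed.

Lemma sum_line_count d : (\sum_c line_count d c = #|S|)%N.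
Proof.
rewrite -sum1_card (partition_big (form d) xpredT) //=; apply: eq_bigr => c _.
by rewrite sum1_card; apply: eq_card => p; rewrite !inE in_line.
Qed.

(** A point of S other than [p] lies on one line through [p], and [p] itself on
all fourteen. *)
Lemma pencil_count p : (\sum_d line_count d (form d p) = #|S| + 13 * (p \in S))%N.
Proof.
transitivity (\sum_(q in S) #|[set d | form d q == form d p]|)%N.
  under eq_bigr do rewrite line_countE.
  rewrite exchange_big /=; apply: eq_bigr => q _.
  by rewrite -sum1dep_card [RHS]big_mkcond.
have -> : (#|S| = \sum_(q in S) 1)%N by rewrite sum1_card.
case: (boolP (p \in S)) => pS; last first.
  rewrite addn0; apply: eq_bigr => q qS; apply: form_sep.
  by apply: contraNneq pS => <-.
rewrite !(bigD1 p pS) /= addnAC; congr (_ + _)%N; last first.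
  by apply: eq_bigr => q /andP[_ neq]; apply: form_sep.
transitivity #|{: direction}|; last by rewrite card_direction.
by apply: eq_card => d; rewrite !inE eqxx.
Qed.

Lemma nonspecialP d :
  reflect (forall c c', line_count d c = line_count d c') (d \notin special_directions S).
Proof.
rewrite inE negbK; apply: (iffP idP) => [/'forall_'forall_eqP // | eqc].
by apply/'forall_'forall_eqP.
Qed.

Lemma nonspecial_count d c :
  d \notin special_directions S -> (13 * line_count d c = #|S|)%N.
Proof.
move=> /nonspecialP eqc; rewrite -(sum_line_count d).
by rewrite (eq_bigr (fun=> line_count d c)) // sum_nat_const card_Fp.
Qed.

(** This is [pencil_count] with the non-special directions moved to the right;
the summand [k] on the left keeps the equation free of truncated subtraction. *)
Lemma special_sum k p : #|S| = (13 * k)%N ->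
  (\sum_(d in special_directions S) line_count d (form d p) + k
   = #|special_directions S| * k + 13 * (p \in S))%N.
Proof.
move=> cardS; have := pencil_count p.
rewrite (bigID (mem (special_directions S))) /=.
rewrite [X in (_ + X)%N](eq_bigr (fun=> k)); last first.
  move=> d /(nonspecial_count (form d p)).
  by rewrite cardS => /eqP; rewrite eqn_pmul2l // => /eqP.
rewrite sum_nat_const cardS.
have := cardC (mem (special_directions S)); rewrite card_direction /=.
set A := #|special_directions S|; set B := #|_|; nia.
Qed.

(** If S is a union of lines of direction [d], a line of any other direction
meets S once for each of these lines. *)
Lemma parallel_special d d' :
  (forall c, line_count d c = 0%N \/ line_count d c = 13%N) -> d' != d ->
  d' \notin special_directions S.
Proof.
move=> full neq; apply/nonspecialP.
suff E c : line_count d' c = (\sum_t (line_count d t == 13%N))%N by move=> c c'; rewrite !E.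
rewrite line_count_mem -(sum_line (fun t => line_count d t == 13%N : nat) c neq).
apply: eq_bigr => p _; congr nat_of_bool.
have pl : p \in line d (form d p) by rewrite in_line.
have [e|e] := full (form d p); rewrite e.
  by have := cards0_eq e; move/setP/(_ p); rewrite !inE pl andbT.
have : S :&: line d (form d p) == line d (form d p).
  by rewrite eqEcard subsetIr card_line -[#|_|]/(line_count _ _) e.
by move/eqP/setIidPr/subsetP/(_ p pl) => ->.
Qed.

End LineCounts.

(** * Finite differences *)

Definition diff (f : F -> F) (t : F) := f (t + 1) - f t.

Lemma diff_kernel (f : F -> F) : (forall t, f (t + 1) = f t) -> forall t, f t = f 0.
Proof.
move=> step t; rewrite -[t]natr_Zp; elim: (nat_of_ord t) => // n <-.
by rewrite -(step n%:R) -natr1.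
Qed.

Lemma eq_iter_diff n (f g : F -> F) : f =1 g -> iter n diff f =1 iter n diff g.
Proof. by move=> eqfg; elim: n => //= n IH t; rewrite /diff !IH. Qed.

(** Translating the identity by a vector [v] in the kernel of [form e] and
subtracting eliminates the term of direction [e] and replaces every other
[N d] by a difference with step [form d v]. Choosing [form d0 v = 1] makes the
step along [d0] equal to 1, and the number of directions drops by one. The
right-hand side [C] survives only if nothing is eliminated. *)
Lemma iter_diff_slice n (D : {set direction}) (N : direction -> F -> F) C d0 :
  #|D| = n.+1 -> d0 \in D ->
  (forall p, \sum_(d in D) N d (form d p) = C) ->
  forall t, iter n diff (N d0) t = C *+ (n == 0).
Proof.
elim: n D N C => [|n IH] D N C cardD d0D sumN t.
  have /cards1P[d defD] : #|D| == 1%N by rewrite cardD.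
  move: d0D sumN; rewrite defD inE => /eqP <- sumN.
  by have [p <-] := form_surj d0 t; rewrite -(sumN p) big_set1.
have [e] : exists e, e \in D :\ d0.
  by apply/set0Pn; rewrite -card_gt0; move: cardD; rewrite (cardsD1 d0) d0D; lia.
rewrite !inE => /andP[neq eD].
have [v [ve vd0]] := form_dual 0 1 neq.
pose N' d t := N d (t + form d v) - N d t.
rewrite iterSr mulr0n.
have eqN : diff (N d0) =1 N' d0 by move=> s; rewrite /N' vd0.
rewrite (eq_iter_diff n eqN) (IH (D :\ e) N' 0) ?mul0rn //.
- by move: cardD; rewrite (cardsD1 e) eD => -[].
- by rewrite !inE eq_sym neq.
move=> p; transitivity (\sum_(d in D) N' d (form d p)).
  rewrite [RHS](bigD1 e) //= {2}/N' ve addr0 subrr add0r.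
  by apply: eq_bigl => d; rewrite !inE andbC.
rewrite sumrB (sumN p) -(sumN ((p : F * F) + v)) -sumrB.
by rewrite big1 // => d _; rewrite formD subrr.
Qed.

Lemma two_neq0 : 2 != 0 :> F. Proof. by []. Qed.

(** Over F_13, a function with vanishing difference is constant. Subtracting
from [f] the quadratic polynomial with the same first two differences at 0
therefore leaves a constant. *)
Lemma diff3_quadratic (f : F -> F) : (forall t, iter 3 diff f t = 0) ->
  exists a b c, forall t, f t = a * t ^+ 2 + b * t + c.
Proof.
move=> d3; have two := two_neq0.
have d2 t : iter 2 diff f t = iter 2 diff f 0.
  apply: (diff_kernel (f := iter 2 diff f)) => s.
  by apply/eqP; rewrite -subr_eq0; apply/eqP/d3.
pose a := iter 2 diff f 0 / 2; pose b := diff f 0 - a.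
pose g t := f t - (a * t ^+ 2 + b * t).
have dg t : diff g t = diff g 0.
  apply: (diff_kernel (f := diff g)) => s.
  have := d2 s; rewrite /g /a /= /diff => h.
  apply/eqP; rewrite -subr_eq0; apply/eqP.
  by rewrite -[RHS](subrr (iter 2 diff f s)) {2}d2 /= /diff; field.
have g1 t : g t = g 0.
  apply: (diff_kernel (f := g)) => s; apply/eqP; rewrite -subr_eq0 -/(diff g s) dg.
  by apply/eqP; rewrite /diff /g /b /diff; ring.
exists a, b, (g 0) => t; rewrite -(g1 t) /g; ring.
Qed.

(** * Residues of quadratic polynomials *)

(** This lemma and the next one turn statements over F_13 into closed
computations over the list of residues. *)
Lemma all2_F13 (P : F -> F -> bool) :
  all (fun i => all (fun j => P (inZp i) (inZp j)) (iota 0 13)) (iota 0 13) ->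
  forall x y, P x y.
Proof.
move=> table x y; rewrite -[x]valZpK -[y]valZpK.
have ord_iota (z : F) : nat_of_ord z \in iota 0 13 by rewrite mem_iota ltn_ord.
exact: (allP (allP table x (ord_iota x)) y (ord_iota y)).
Qed.

Lemma sum_F13 (g : F -> nat) :
  (\sum_t g t = sumn [seq g (inZp i) | i <- iota 0 13])%N.
Proof.
rewrite sumnE big_map -[iota 0 13]/(index_iota 0 13) big_mkord.
by apply: eq_bigr => t _; rewrite valZpK.
Qed.

(** The residues of [a t^2] are 0 and, twice each, either the six nonzero squares
or the six non-squares. Only two shifts bring their sum down to 52: by 4 in the
case of squares, by 8 in the case of non-squares. *)
Lemma sum_quadratic_residues (a c : F) : a != 0 ->
  (52 <= \sum_t ((a * t ^+ 2 + c)%R : F))%N /\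
  ((\sum_t ((a * t ^+ 2 + c)%R : F))%N = 52%N -> c = 4%N :> nat \/ c = 8%N :> nat).
Proof.
rewrite sum_F13 => nz; pose m := fun a c : F =>
  sumn [seq nat_of_ord (a * inZp i ^+ 2 + c) | i <- iota 0 13].
pose P a c := (a != 0) ==> (52 <= m a c)%N &&
  ((m a c == 52%N) ==> ((c == 4%N :> nat) || (c == 8%N :> nat))).
have allP : all (fun i => all (fun j => P (inZp i) (inZp j)) (iota 0 13)) (iota 0 13).
  by vm_compute.
have := all2_F13 allP a c.
move=> /implyP/(_ nz)/andP[ge52 /implyP eq52]; rewrite -/(m a c); split; first exact: ge52.
by move=> /eqP/eq52/orP[/eqP|/eqP]; [left|right].
Qed.

(** The residue of [n t] modulo 13 is at most [n t], so a total of at most 52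
leaves little room for the residues of the quadratic polynomial that [n]
represents. When that polynomial has degree two, the total must be exactly 52,
and then [n t] equals its residue for every [t]. *)
Lemma small_profile (n : F -> nat) :
  (forall t, iter 3 diff (fun t => (n t)%:R) t = 0) -> (\sum_t n t <= 52)%N ->
  (forall t, (n t)%:R = (n 0)%:R :> F) \/
  (\sum_t n t = 52)%N /\ exists a s, [/\ a != 0, n s = 4%N \/ n s = 8%N &
    forall t, (n t)%:R = a * (t - s) ^+ 2 + (n s)%:R].
Proof.
move=> /diff3_quadratic[a [b [c quad]]] small.
have val_n t : nat_of_ord ((n t)%:R : F) = (n t %% 13)%N by rewrite val_Fp_nat.
have le_n t : (((a * t ^+ 2 + b * t + c)%R : F) <= n t)%N.
  by rewrite -quad val_n leq_mod.
have [a0|a_nz] := eqVneq a 0.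
  left=> t; have [b0|b_nz] := eqVneq b 0.
    by rewrite !quad a0 b0 !mul0r.
  (* A bijective affine function takes every residue once, with sum 78 > 52. *)
  have : (\sum_t ((b * t + c)%R : F) <= \sum_t n t)%N.
    by apply: leq_sum => u _; have := le_n u; rewrite a0 mul0r add0r.
  have inj : injective (fun u : F => (u - c) / b).
    by move=> u v /(mulIf _)/addIr; apply; rewrite invr_eq0.
  rewrite (reindex_inj inj) (eq_bigr (fun u : F => nat_of_ord u)); last first.
    by move=> u _; have -> : b * ((u - c) / b) + c = u by field.
  by move=> /leq_trans/(_ small); rewrite sum_F13; vm_compute.
right; have two := two_neq0.
pose s := - b / (2 * a); pose c' := c - b ^+ 2 / (4 * a).
have four : 4 != 0 :> F by [].
have square t : (n t)%:R = a * (t - s) ^+ 2 + c'.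
  rewrite quad /s /c'; field; rewrite ?a_nz ?two ?four //.
have ns : (n s)%:R = c' by rewrite square subrr expr0n mulr0 add0r.
(* The sum of the residues does not see the position of the vertex. *)
have shift : (\sum_t n t %% 13 = \sum_t ((a * t ^+ 2 + c')%R : F))%N.
  rewrite [RHS](reindex_inj (addIr (- s))); apply: eq_bigr => t _.
  by rewrite -val_n square.
have le_mod : (\sum_t n t %% 13 <= \sum_t n t)%N by apply: leq_sum => t _; apply: leq_mod.
have [ge52 eq52] := sum_quadratic_residues c' a_nz.
have sum52 : (\sum_t n t = 52)%N by lia.
split=> //; exists a, s; split=> //; last by move=> t; rewrite square ns.
have : (\sum_t (n t - n t %% 13) = 0)%N.
  by rewrite sumnB => [|t _]; [lia | apply: leq_mod].
move/eqP; rewrite sum_nat_eq0 => /forall_inP/(_ s isT) nss.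
have -> : n s = c' by rewrite -ns val_n; have := leq_mod (n s) 13; lia.
by apply: eq52; lia.
Qed.

(** Two of the vertices determine a point [p]. Around [p] the terms of the two
corresponding directions are symmetric, so they cancel from the difference of
the identity at [p + v] and [p - v]. What remains is a relation between linear
functions of two independent forms, so both functions vanish: this says that
the remaining vertices are the levels of [p] too. *)
Lemma common_centre (D : {set direction}) (N : direction -> F -> F)
    (a s b : direction -> F) C :
  #|D| = 4%N -> (forall p, \sum_(d in D) N d (form d p) = C) ->
  (forall d, d \in D -> a d != 0) ->
  (forall d t, d \in D -> N d t = a d * (t - s d) ^+ 2 + b d) ->
  exists p, forall d, d \in D -> form d p = s d.
Proof.
move=> cardD sumN a_nz defN.
have /card_gt1P[d1 [d2 [d1D d2D neq12]]] : (1 < #|D|)%N by rewrite cardD.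
have [p [p1 p2]] := form_dual (s d1) (s d2) neq12.
exists p => d dD.
have [->//|ne1] := eqVneq d d1; have [->//|ne2] := eqVneq d d2.
(* [M d h] is [N d (form d p + h) - N d (form d p - h)]. *)
pose M d h := 4 * a d * (form d p - s d) * h.
have cardD' : #|D :\ d1 :\ d2| = 2%N.
  move: cardD; rewrite (cardsD1 d1) d1D (cardsD1 d2 (D :\ d1)) !inE d2D eq_sym neq12.
  by case.
have dD' : d \in D :\ d1 :\ d2 by rewrite !inE ne1 ne2.
have sumM v : \sum_(d in D :\ d1 :\ d2) M d (form d v) = 0.
  transitivity (\sum_(d in D) M d (form d v)).
    rewrite [RHS](bigD1 d1) //= {2}/M p1 subrr mulr0 mul0r add0r.
    rewrite [RHS](bigD1 d2) /= ?d2D 1?eq_sym // {2}/M p2 subrr mulr0 mul0r add0r.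
    by apply: eq_bigl => e; rewrite !inE; case: (e \in D) (e == d1) (e == d2) => [] [] [].
  rewrite -[RHS](subrr C) -{1}(sumN ((p : F * F) + v)) -(sumN ((p : F * F) - v)) -sumrB.
  by apply: eq_bigr => e eD; rewrite !defN // formD formB /M; ring.
have := iter_diff_slice cardD' dD' sumM 0.
rewrite /= /diff /M mulr0 subr0 add0r mulr1 mul0rn => /eqP.
by rewrite !mulf_eq0 (negbTE (a_nz d dD)) subr_eq0 => /eqP.
Qed.

(** * Four special directions need 65 points *)

Lemma four_special_lower_bound (S : {set plane}) :
  #|special_directions S| = 4%N -> (65 <= #|S|)%N.
Proof.
set D := special_directions S => card4; rewrite leqNgt; apply/negP => small.
have [d0 d0D] : exists d, d \notin D.
  apply/existsP; rewrite -negb_forall; apply/negP => /forallP all_special.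
  have sub : {: direction} \subset D by apply/subsetP => d _.
  by have := subset_leq_card sub; rewrite card4 card_direction.
pose n := line_count S; pose k := n d0 0.
have cardS : (#|S| = 13 * k)%N by rewrite (nonspecial_count 0 d0D).
have sum_n p : (\sum_(d in D) n d (form d p) + k = 4 * k + 13 * (p \in S))%N.
  by have := special_sum p cardS; rewrite -/D card4.
have sumF p : \sum_(d in D) (n d (form d p))%:R = (3 * k)%:R :> F.
  rewrite -natr_sum; have -> : (\sum_(d in D) n d (form d p) = 3 * k + 13 * (p \in S))%N.
    by have := sum_n p; lia.
  by rewrite natrD (natrM _ 13) pchar_Fp_0 // mul0r addr0.
have quad d : exists as_ : F * F, d \in D ->
    [/\ (\sum_t n d t = 52)%N, as_.1 != 0, n d as_.2 = 4%N \/ n d as_.2 = 8%N &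
    forall t, (n d t)%:R = as_.1 * (t - as_.2) ^+ 2 + (n d as_.2)%:R].
  case: (boolP (d \in D)) => [dD|]; last by exists 0.
  have d3 t : iter 3 diff (fun t => (n d t)%:R) t = 0.
    by rewrite (iter_diff_slice (N := fun d t => (n d t)%:R) card4 dD sumF).
  have le52 : (\sum_t n d t <= 52)%N by rewrite sum_line_count; lia.
  have [const|] := small_profile d3 le52; last by case=> e [a [s [? ? ?]]]; exists (a, s).
  have cong t : (n d t = n d 0%R %[mod 13])%N.
    by rewrite -!(val_Fp_nat (isT : prime 13)) const.
  (* A constant residue other than 0 would force [n d] itself to be constant. *)
  have full t : n d t = 0%N \/ n d t = 13%N.
    have [ge13|lt13] := leqP 13 (n d t).
      by right; have := line_count_le S d t; rewrite -/(n d t); lia.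
    have [|pos] := posnP (n d t); first by left.
    suff /nonspecialP : forall u v, line_count S d u = line_count S d v by rewrite dD.
    suff eqt u : n d u = n d t by move=> u v; rewrite -!/(n d _) !eqt.
    have := cong t; have := cong u.
    have := line_count_le S d u; rewrite -/(n d u); lia.
  have /card_gt1P[d1 [d2 [d1D d2D neq12]]] : (1 < #|D|)%N by rewrite card4.
  have [e eD neq] : exists2 e, e \in D & e != d.
    by have [eq1|] := eqVneq d1 d; [exists d2; rewrite // -eq1 eq_sym | exists d1].
  by have := parallel_special full neq; rewrite eD.
have [as_ quadP] := fin_all_exists quad.
have [p centre] : exists p, forall d, d \in D -> form d p = (as_ d).2.
  apply: (common_centre (N := fun d t => (n d t)%:R) (a := fun d => (as_ d).1)
    (b := fun d => (n d (as_ d).2)%:R) card4 sumF).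
    by move=> d /quadP[].
  by move=> d t /quadP[].
have k4 : k = 4%N.
  have /card_gt0P[d /quadP[+ _ _ _]] : (0 < #|D|)%N by rewrite card4.
  by rewrite sum_line_count cardS; lia.
have n48 d : d \in D -> n d (form d p) = 4%N \/ n d (form d p) = 8%N.
  by move=> dD; rewrite centre //; case: (quadP d dD).
have ge16 : (16 <= \sum_(d in D) n d (form d p))%N.
  rewrite -[16%N]/(4 * 4)%N -{1}card4 -sum_nat_const.
  by apply: leq_sum => d /n48; lia.
have dvd4 : (4 %| \sum_(d in D) n d (form d p))%N.
  by apply: dvdn_sum => d /n48[] ->.
by have := sum_n p; rewrite k4; case: (p \in S) dvd4 ge16 => /=; lia.
Qed.

(** * A set of 65 points with four special directions *)

(** Sum the identity over the points of a line of direction [d]: each profile of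
another direction is summed over all its levels and contributes [13 * k],
while the profile of [d] itself is constant on the line. *)
Lemma line_count_of_profile (S D : {set _}) (n : direction -> F -> nat) j k :
  #|D| = j.+1 -> (forall d, d \in D -> \sum_t n d t = 13 * k)%N ->
  (forall p, \sum_(d in D) n d (form d p) = j * k + 13 * (p \in S))%N ->
  forall d c, line_count S d c = if d \in D then n d c else k.
Proof.
move=> cardD sum_n sum_prof d c.
have own : (\sum_(p in line d c) n d (form d p) = 13 * n d c)%N.
  rewrite -(card_line d c) -sum_nat_const; apply: eq_bigr => p.
  by rewrite in_line => /eqP ->.
have other e : e \in D -> e != d -> (\sum_(p in line d c) n e (form e p) = 13 * k)%N.
  by move=> eD ne; rewrite sum_line 1?eq_sym ?sum_n.
have : (\sum_(p in line d c) \sum_(e in D) n e (form e p)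
        = 13 * (j * k) + 13 * line_count S d c)%N.
  under eq_bigr do rewrite sum_prof.
  by rewrite big_split /= sum_nat_const card_line line_count_mem big_distrr.
rewrite exchange_big /=; case: ifP => dD.
  rewrite (bigD1 d) //= own (eq_bigr (fun=> 13 * k)%N) => [|e /andP[]]; last exact: other.
  rewrite sum_nat_const (_ : #|_| = j); first by lia.
  have := cardD; rewrite (cardsD1 d) dD => -[<-].
  by apply: eq_card => e; rewrite !inE andbC.
rewrite (eq_bigr (fun=> 13 * k)%N) => [|e eD]; last first.
  by apply: other => //; apply: contraFneq dD => <-.
by rewrite sum_nat_const cardD; nia.
Qed.

(** The forms of these directions are x, y, y - x and y + x: they divide the line
at infinity harmonically. *)
Definition harmonic_directions : seq direction :=
  [:: None; Some 0; Some 1; Some (-1)].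

(** The leading coefficients -2, -2, 1, 1 are those of the linear relation
between the squares of the four forms. The constants 9 (for a non-square
leading coefficient) and 5 (for a square one) make the residues sum to
65 in each direction; no residue is then 0. *)
Definition conic_profile (d : direction) (t : F) : nat :=
  if d \in [:: None; Some 0] then 9 - 2 * t ^+ 2 : F else 5 + t ^+ 2 : F.

Definition conic_level_set : {set plane} :=
  [set p | (\sum_(d <- harmonic_directions) conic_profile d (form d p) == 28)%N].

Lemma conic_profile_sum p :
  (\sum_(d <- harmonic_directions) conic_profile d (form d p)
   = 3 * 5 + 13 * (p \in conic_level_set))%N.
Proof.
rewrite inE; pose m (p : plane) :=
  sumn [seq conic_profile d (form d p) | d <- harmonic_directions].
have -> : (\sum_(d <- harmonic_directions) conic_profile d (form d p))%N = m p.
  by rewrite /m sumnE big_map.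
pose P x y := (m (x, y) == 15%N) || (m (x, y) == 28%N).
have allP : all (fun i => all (fun j => P (inZp i) (inZp j)) (iota 0 13)) (iota 0 13).
  by vm_compute.
have := all2_F13 allP p.1 p.2.
by rewrite /P -surjective_pairing => /orP[] /eqP ->.
Qed.

Lemma four_special_example :
  #|special_directions conic_level_set| = 4%N /\ #|conic_level_set| = 65%N.
Proof.
set S := conic_level_set; pose D := [set d in harmonic_directions].
have uniq_ds : uniq harmonic_directions by vm_compute.
have cardD : #|D| = 4%N by rewrite cardsE (card_uniqP uniq_ds).
have counts : forall d c, line_count S d c = if d \in D then conic_profile d c else 5%N.
  apply: (line_count_of_profile (j := 3)) => //.
    move=> d; rewrite inE sum_F13 => dds.
    suff /allP/(_ d dds)/eqP // : all (fun d => sumn [seq conic_profile d (inZp i) |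
      i <- iota 0 13] == (13 * 5)%N) harmonic_directions.
    by vm_compute.
  move=> p; rewrite -conic_profile_sum (big_uniq _ uniq_ds).
  by apply: eq_bigl => d; rewrite inE.
split; last first.
  rewrite -(sum_line_count S None) (eq_bigr (conic_profile None)) => [|c _].
    by rewrite sum_F13; vm_compute.
  by rewrite counts !inE.
rewrite -cardD; apply: eq_card => d.
apply/idP/idP; apply: contraTT.
  by move=> dD; apply/nonspecialP => c c'; rewrite !counts (negbTE dD).
move/nonspecialP => const; apply/negP => dD; have := const 0 1.
by rewrite !counts dD /conic_profile; case: ifP => _; vm_compute.
Qed.

Close Scope ring_scope.

Theorem corollary1p2 :
  (exists S : {set plane}, #|special_directions S| = 4 /\ #|S| = 65) /\
  (forall S : {set plane}, #|special_directions S| = 4 -> 65 <= #|S|).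
Proof.
split; first by exists conic_level_set; exact: four_special_example.
exact: four_special_lower_bound.
Qed.
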